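(* For all positive integers $n$, $C_n(132,213) \le n^2 \cdot 2^{n/2}$.
   Context: Let $\mathfrak{S}_n$ denote the set of permutations of $[n]=\{1,\ldots,n\}$. For $\sigma\in\mathfrak{S}_k$, a permutation $\pi\in\mathfrak{S}_n$ contains $\sigma$ if there exist indices $1\le i_1<\cdots<i_k\le n$ such that $\pi_{i_1}\pi_{i_2}\cdots\pi_{i_k}$ is in the same relative order as $\sigma_1\sigma_2\cdots\sigma_k$; otherwise $\pi$ avoids $\sigma$. $C_n(132,213)$ denotes the number of permutations $\pi\in\mathfrak{S}_n$ that avoid both patterns $132$ and $213$ and whose cycle decomposition consists of a single $n$-cycle. *)

(* Defs.v *)
From mathcomp Require Import all_boot all_fingroup.

Set Implicit Arguments.
Unset Strict Implicit.
Unset Printing Implicit Defensive.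

(* Permutations of [n] are elements of 'S_n, with positions and values shifted
   down by one to 'I_n = {0, .., n-1}. *)

(* f a is the position i_(a+1) in an occurrence of sigma in pi. *)
Definition contains (k n : nat) (sigma : 'S_k) (pi : 'S_n) : bool :=
  [exists f : {ffun 'I_k -> 'I_n},
     [forall a : 'I_k, forall b : 'I_k, (a < b) ==> (f a < f b)] &&
     [forall a : 'I_k, forall b : 'I_k,
        (pi (f a) < pi (f b)) == (sigma a < sigma b)]].

Definition avoids (k n : nat) (sigma : 'S_k) (pi : 'S_n) : bool :=
  ~~ contains sigma pi.

Definition one_line (n : nat) (s : 'S_n) : seq nat :=
  [seq (val (s i)).+1 | i <- enum 'I_n].

Definition p132 : 'S_3 := tperm (@Ordinal 3 1 isT) (@Ordinal 3 2 isT).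
Definition p213 : 'S_3 := tperm (@Ordinal 3 0 isT) (@Ordinal 3 1 isT).

Lemma one_line_p132 : one_line p132 = [:: 1; 3; 2].
Proof. by rewrite /one_line !enum_ordSl enum_ord0 /= !permE. Qed.

Lemma one_line_p213 : one_line p213 = [:: 2; 1; 3].
Proof. by rewrite /one_line !enum_ordSl enum_ord0 /= !permE. Qed.

(* porbits counts fixed points as cycles of length 1, and the cycles of pi
   partition 'I_n, so a single cycle is necessarily an n-cycle. *)
Definition is_cyclic (n : nat) (pi : 'S_n) : bool := #|porbits pi| == 1.

Definition C (n k l : nat) (sigma : 'S_k) (tau : 'S_l) : nat :=
  #|[set pi : 'S_n | [&& avoids sigma pi, avoids tau pi & is_cyclic pi]]|.

(* Main.v *)
Require Import Defs.
From mathcomp Require Import all_boot all_order all_algebra all_fingroup.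
From mathcomp Require Import all_classical all_reals all_analysis.
From mathcomp Require Import zify.
Import Order.TTheory GRing.Theory Num.Theory.

(* If [pi] avoids 132 and 213, its complement [t = pi * rev_perm n] is layered:
   an increasing sequence of decreasing runs. Hence [t] is an involution, and it
   is determined by the set of [p] such that [t] preserves [0, p).  If [pi] is
   an [n]-cycle, then [t] and [rev_perm n] generate a dihedral group acting on
   an [n]-gon, so the reflection [t] fixes at most two points.  As [t] fixes a
   point in every preserved interval of odd length, the parity of the preserved
   prefixes [p] follows the pattern even, odd, even with at most two switches.
   The two switches can be chosen in [n ^ 2] ways; between them the parity is
   prescribed, so that each pair [2 j + 1, 2 j + 2] leaves one binary choice. *)

Set Implicit Arguments.
Unset Strict Implicit.

Local Open Scope nat_scope.


(** * Pattern avoidance and layered permutations *)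

Lemma avoids_p132 (n : nat) (pi : 'S_n) (i j k : 'I_n) :
  avoids p132 pi -> i < j -> j < k -> ~ (pi i < pi k < pi j).
Proof.
move=> /negP av ij jk /andP[ik kj]; apply: av; apply/existsP.
exists [ffun a : 'I_3 => nth i [:: i; j; k] a].
apply/andP; split; apply/forallP => -[[|[|[|//]]] ha];
  apply/forallP => -[[|[|[|//]]] hb];
  rewrite /p132 !ffunE ?permE /=; lia.
Qed.

Lemma avoids_p213 (n : nat) (pi : 'S_n) (i j k : 'I_n) :
  avoids p213 pi -> i < j -> j < k -> ~ (pi j < pi i < pi k).
Proof.
move=> /negP av ij jk /andP[ik kj]; apply: av; apply/existsP.
exists [ffun a : 'I_3 => nth i [:: i; j; k] a].
apply/andP; split; apply/forallP => -[[|[|[|//]]] ha];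
  apply/forallP => -[[|[|[|//]]] hb];
  rewrite /p213 !ffunE ?permE /=; lia.
Qed.

Lemma card_ord_lt (n m : nat) : m <= n -> #|[set x : 'I_n | x < m]| = m.
Proof.
move=> le_mn; have inj_w : injective (widen_ord le_mn).
  by move=> x y /(congr1 val) /= /val_inj.
rewrite -[RHS]card_ord -[RHS](card_imset _ inj_w).
apply: eq_card => x; rewrite inE; apply/idP/imsetP => [x_m|[y _ ->]].
  by exists (Ordinal x_m) => //; apply: val_inj.
exact: (ltn_ord y).
Qed.

Definition rev_perm (n : nat) : 'S_n := perm (@rev_ord_inj n).

(** The two excluded orders are the patterns 231 and 312, the complements of 213 and 132. *)
Definition layered (n : nat) (t : 'S_n) : Prop :=
  forall i j k : 'I_n, i < j -> j < k ->
    ~ (t k < t i < t j) /\ ~ (t j < t k < t i).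

Definition stable_prefix (n : nat) (t : 'S_n) (p : nat) : bool :=
  [forall a : 'I_n, (a < p) == (t a < p)].

Lemma stable_prefixP (n : nat) (t : 'S_n) (p : nat) :
  reflect (forall a : 'I_n, (a < p) = (t a < p)) (stable_prefix t p).
Proof. by apply: (iffP forallP) => c a; [exact: (eqP (c a)) | rewrite c]. Qed.

Lemma stable_prefixV (n : nat) (t : 'S_n) (p : nat) :
  stable_prefix t^-1%g p = stable_prefix t p.
Proof.
apply/stable_prefixP/stable_prefixP => c a; first by rewrite [RHS]c permK.
by rewrite [RHS]c permKV.
Qed.

(** 231 and 312 are inverse permutations, so inversion swaps the two conditions. *)
Lemma layeredV (n : nat) (t : 'S_n) : layered t -> layered t^-1%g.
Proof.
move=> lay i j k ij jk; split=> /andP[lt1 lt2].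
  by have [_] := lay _ _ _ lt1 lt2; rewrite !permKV ij jk.
by have [+ _] := lay _ _ _ lt1 lt2; rewrite !permKV ij jk.
Qed.

Lemma avoids_layered (n : nat) (pi : 'S_n) :
  avoids p132 pi -> avoids p213 pi -> layered (pi * rev_perm n)%g.
Proof.
move=> av1 av2 i j k ij jk; rewrite !permM !permE /=.
have /= := (ltn_ord (pi i), ltn_ord (pi j), ltn_ord (pi k)).
case=> -[hi hj] hk.
have := avoids_p132 av1 ij jk; have := avoids_p213 av2 ij jk; lia.
Qed.

(** * Stable prefixes determine a layered permutation *)

(* The first position after [i] whose value exceeds [t i] starts a new layer. *)
Lemma layered_stable_prefix (n : nat) (t : 'S_n) (i j : 'I_n) :
  layered t -> i < j -> t i < t j -> exists2 p, i < p <= j & stable_prefix t p.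
Proof.
move=> lay ij tij.
have [|p /andP[ip tip] minp] :=
  @arg_minnP _ j (fun k => (i < k) && (t i < t k)) (@nat_of_ord n).
  by rewrite ij.
exists p => /=; first by rewrite ip minp // ij.
(* Otherwise [i], [p], [b] would form a 231. *)
have ge_p (b : 'I_n) : p <= b -> t i < t b.
  rewrite leq_eqVlt => /orP[/eqP/val_inj <- //|pb].
  have [] := lay _ _ _ ip pb.
  have : t i != t b :> nat
    by rewrite (inj_eq val_inj) (inj_eq perm_inj) neq_ltn (ltn_trans ip pb).
  lia.
have sep (a b : 'I_n) : a < p -> p <= b -> t a < t b.
  move=> ap pb; have tib := ge_p b pb.
  have [ia|ai|/val_inj <- //] := ltngtP i a.
    by have := minp a; rewrite ia /=; lia.
  have ib : i < b by apply: leq_trans pb.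
  have [_] := lay _ _ _ ai ib.
  have : t a != t b :> nat
    by rewrite (inj_eq val_inj) (inj_eq perm_inj) neq_ltn (leq_trans ap pb).
  lia.
(* By [sep], the [p] values taken before position [p] all lie below [t b]. *)
have up (b : 'I_n) : p <= b -> p <= t b.
  move=> pb.
  rewrite -[X in X <= _](card_ord_lt (ltnW (ltn_ord p))).
  rewrite -[X in _ <= X](card_ord_lt (ltnW (ltn_ord (t b)))).
  rewrite -(card_imset _ (@perm_inj _ t)) subset_leq_card //.
  by apply/fintype.subsetP => _ /imsetP[a + ->]; rewrite !inE => ap; apply: sep.
have img : t @: [set b : 'I_n | p <= b] = [set b : 'I_n | p <= b].
  apply/eqP; rewrite eqEcard (card_imset _ (@perm_inj _ t)) leqnn andbT.
  by apply/fintype.subsetP => _ /imsetP[b + ->]; rewrite !inE => /up.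
apply/stable_prefixP => a; apply/idP/idP; rewrite !ltnNge;
  apply: contra; last exact: up.
move=> pta; have : t a \in t @: [set b : 'I_n | p <= b] by rewrite img inE.
by rewrite (mem_imset _ _ (@perm_inj _ t)) inE.
Qed.

(** Values increase across a layer boundary and decrease inside a layer. *)
Lemma layered_lt (n : nat) (t : 'S_n) (i j : 'I_n) : layered t -> i < j ->
  (t i < t j) = [exists p : 'I_n, (i < p <= j) && stable_prefix t p].
Proof.
move=> lay ij; apply/idP/existsP.
  case/(layered_stable_prefix lay ij) => p ipj cp.
  have pn : p < n by case/andP: ipj => _ /leq_ltn_trans; apply.
  by exists (Ordinal pn); rewrite ipj.
case=> p /andP[/andP[ip pj] /stable_prefixP c]; have := c i; have := c j.
by rewrite ip ltnNge pj /=; lia.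
Qed.

(** The value [s i] is the number of [x] with [s x < s i]. *)
Lemma perm_lt_inj (n : nat) (s t : 'S_n) :
  (forall i j : 'I_n, i < j -> (s i < s j) = (t i < t j)) -> s = t.
Proof.
move=> st; have lt_st i j : (s i < s j) = (t i < t j).
  have [ij|ji|/val_inj ->] := ltngtP i j; [exact: st| |by rewrite !ltnn].
  have := st _ _ ji.
  have : s i != s j :> nat
    by rewrite (inj_eq val_inj) (inj_eq perm_inj) neq_ltn ji orbT.
  have : t i != t j :> nat
    by rewrite (inj_eq val_inj) (inj_eq perm_inj) neq_ltn ji orbT.
  lia.
have card_lt (u : 'S_n) i : #|[set x | u x < u i]| = u i.
  rewrite -(card_imset _ (@perm_inj _ u)).
  rewrite -[RHS](card_ord_lt (ltnW (ltn_ord (u i)))).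
  apply: eq_card => y; rewrite inE.
  apply/imsetP/idP => [[x + ->]|yi]; first by rewrite inE.
  by exists (u^-1 y)%g; rewrite ?inE permKV.
apply/permP => i; apply: val_inj; rewrite /= -card_lt -[RHS]card_lt.
by apply: eq_card => x; rewrite !inE lt_st.
Qed.

Lemma layered_stable_prefix_inj (n : nat) (s t : 'S_n) : layered s -> layered t ->
  (forall p : 'I_n, 0 < p -> stable_prefix s p = stable_prefix t p) -> s = t.
Proof.
move=> ls lt st; apply: perm_lt_inj => i j ij; rewrite !layered_lt //.
apply: eq_existsb => p; case: ltnP => //= ip; rewrite st //.
exact: leq_trans ip.
Qed.

(** [t] and its inverse are both layered, with the same stable prefixes. *)
Lemma layered_involutive (n : nat) (t : 'S_n) : layered t -> involutive t.
Proof.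
move=> lay; have tV : (t^-1 = t)%g.
  apply: layered_stable_prefix_inj (layeredV lay) lay _ => p _.
  by rewrite stable_prefixV.
by move=> x; rewrite -{1}tV permK.
Qed.


(** * Fixed points and the parity of stable prefixes *)

(* An involution without fixed points pairs up the points of an invariant set. *)
Lemma odd_involutive_fixed (T : finType) (f : T -> T) (A : {set T}) :
  involutive f -> {in A, forall x, f x \in A} -> odd #|A| ->
  exists2 x, x \in A & f x = x.
Proof.
move=> fK; have [m] := ubnP #|A|; elim: m A => // m IHm A ltAm stA oddA.
have /card_gt0P[x xA] : 0 < #|A| by case: #|A| oddA.
have [fxx|fxx] := eqVneq (f x) x; first by exists x.
have cardA : #|A| = #|A :\ x :\ f x|.+2.
  by rewrite (cardsD1 x) xA (cardsD1 (f x)) !inE fxx stA.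
have [|||y] := IHm (A :\ x :\ f x).
- by rewrite cardA in ltAm; lia.
- move=> y; rewrite !inE => /and3P[yfx yx yA].
  by rewrite (inj_eq (inv_inj fK)) yx stA // andbT (inv_eq fK) yfx.
- by move: oddA; rewrite cardA /= negbK.
by rewrite !inE => /and3P[_ _ yA] fy; exists y.
Qed.

Lemma odd_interval_fixed (n : nat) (t : 'S_n) (p q : nat) :
  involutive t -> stable_prefix t p -> stable_prefix t q ->
  p <= q <= n -> odd (q - p) ->
  exists2 x : 'I_n, p <= x < q & t x = x.
Proof.
move=> tK /stable_prefixP cp /stable_prefixP cq /andP[pq qn] odd_qp.
have card_pq : #|[set x : 'I_n | p <= x < q]| = q - p.
  have -> : [set x : 'I_n | p <= x < q]
            = [set x : 'I_n | x < q] :\: [set x : 'I_n | x < p].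
    by apply/finset.setP => x; rewrite !inE -leqNgt.
  rewrite cardsD (finset.setIidPr _) ?card_ord_lt ?(leq_trans pq) //.
  by apply/fintype.subsetP => x; rewrite !inE => /leq_trans; apply.
have [||x] := @odd_involutive_fixed _ t [set x : 'I_n | p <= x < q] tK.
- by move=> x; rewrite !inE -cq leqNgt cp -leqNgt.
- by rewrite card_pq.
by rewrite inE; exists x.
Qed.

(* [t] inverts [pi = t * rev_perm n], so a point [pi ^+ k x] is fixed by [t]
   together with [x] only if [n] divides [2 * k]. *)
Lemma cyclic_fixed (n : nat) (t : 'S_n) (x y z : 'I_n) :
  involutive t -> is_cyclic (t * rev_perm n)%g ->
  t x = x -> t y = y -> t z = z -> [|| x == y, x == z | y == z].
Proof.
move=> tK cyc tx ty tz; pose pi := (t * rev_perm n)%g.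
have revK : involutive (rev_perm n) by move=> u; rewrite !permE rev_ordK.
(* The dihedral relation: [t] conjugates [pi] to its inverse. *)
have pit u : pi (t (pi u)) = t u by rewrite /pi !permM tK revK.
have fixP k : t (iter k pi x) = iter k pi x -> iter (k + k) pi x = x.
  have step m : iter m pi (t (iter m pi x)) = x.
    elim: m => // m IHm; rewrite iterSr iterS pit; exact: IHm.
  by move=> fk; rewrite iterD -{1}fk step.
have orbx : porbit pi x = [set: 'I_n].
  have /cards1P[A orbA] := cyc.
  have orbu u : porbit pi u = A.
    by apply/set1P; rewrite -orbA; apply/imsetP; exists u.
  by apply/finset.setP => u; rewrite inE orbu -(orbu u) porbit_id.
have cardx : #|porbit pi x| = n by rewrite orbx cardsT card_ord.
have iterx : iter n pi x = x by have := iter_porbit pi x; rewrite cardx.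
have iter_inj k : k < n -> iter k pi x = x -> k = 0.
  move=> kn kx; apply/eqP; rewrite -(nth_uniq x _ _ (uniq_traject_porbit pi x))
    ?size_traject ?cardx //.
    by rewrite !nth_traject ?kx //; lia.
  by lia.
(* Here [k < n] and [n] divides [2 k], which leaves at most one fixed point besides [x]. *)
have ex_iter u : t u = u -> exists2 k, u = iter k pi x & k = 0 \/ k + k = n.
  move=> tu; have : u \in porbit pi x by rewrite orbx inE.
  rewrite porbit_traject cardx => /trajectP[k kn uk]; exists k => //.
  have := fixP k; rewrite -uk tu uk => /(_ erefl) kkx.
  have [kkn|nkk|] := ltngtP (k + k) n; last by right.
    by have := iter_inj _ kkn kkx; lia.
  have kkn : iter (k + k - n) pi (iter n pi x) = x by rewrite -iterD subnK // ltnW.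
  by rewrite iterx in kkn; have := iter_inj _ _ kkn; lia.
have [k -> hk] := ex_iter _ ty; have [l -> hl] := ex_iter _ tz.
case: hk => [->|hk]; first by rewrite /= eqxx.
case: hl => [->|hl]; first by rewrite /= eqxx /= orbT.
have kl : k = l by lia.
by rewrite kl eqxx !orbT.
Qed.

(** If [r] were odd, [0, p), [p, q) and [q, r) would each contain a fixed point of [t]. *)
Lemma stable_prefix_parity (n : nat) (t : 'S_n) (p q r : nat) :
  involutive t -> is_cyclic (t * rev_perm n)%g ->
  stable_prefix t p -> stable_prefix t q -> stable_prefix t r ->
  p < q < r -> r <= n ->
  odd p -> ~~ odd q -> ~~ odd r.
Proof.
move=> tK cyc cp cq cr /andP[pq qr] rn op eq; apply/negP => or.
have c0 : stable_prefix t 0 by apply/stable_prefixP => a; rewrite !ltn0.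
have [||x /andP[_ xp] tx] := odd_interval_fixed tK c0 cp; [lia|lia|].
have [||y /andP[py yq] ty] := odd_interval_fixed tK cp cq; [lia|lia|].
have [||z /andP[qz _] tz] := odd_interval_fixed tK cq cr; [lia|lia|].
by have /or3P[] := cyclic_fixed tK cyc tx ty tz => /eqP eqs;
  move: xp py yq qz; rewrite eqs; lia.
Qed.

(** * Encoding sets whose parity switches at most twice *)

(** The value [t = n] means that no index below [n] satisfies [P]. *)
Lemma ex_first (P : pred nat) (n : nat) :
  exists t, [/\ t <= n, forall p, p < t -> ~~ P p & t < n -> P t].
Proof.
elim: n => [|n [t [tn below at_t]]]; first by exists 0.
have [ltn|geq] := ltnP t n.
  by exists t; split=> // [|_]; [exact: leqW | exact: at_t].
have eqtn : t = n by apply/eqP; rewrite eqn_leq tn.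
have [Pn|nPn] := boolP (P n).
  by exists n; split=> //; rewrite -eqtn.
exists n.+1; split=> // [p|]; last by rewrite ltnn.
rewrite ltnS leq_eqVlt => /orP[/eqP->//|]; rewrite -eqtn; exact: below.
Qed.

(** [p.-1./2] is the index [j] of the pair containing [p]. The element [t2] is treated apart because
    its partner [t2 - 1] may be present too. *)
Definition threshold_decode (t1 t2 : nat) (T : pred nat) (p : nat) : bool :=
  (p == t2) || (T p.-1./2 && (odd p == (t1 <= p < t2))).

(* [t1] is the first odd element of [c] and [t2] the first even one after it;
   [T] records, among the pairs [2 j + 1, 2 j + 2], those which meet [c] off
   [t2]. *)
Lemma ex_threshold_decode (n : nat) (c : pred nat) :
  (forall p q r, 0 < p -> p < q < r -> r < n ->
     c p -> c q -> c r -> odd p -> ~~ odd q -> ~~ odd r) ->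
  0 < n ->
  exists t1 t2 (T : pred nat), [/\ 0 < t1 <= n, 0 < t2 <= n &
    forall p, 0 < p < n -> c p = threshold_decode t1 t2 T p].
Proof.
move=> par n0.
have [t1 [t1n below1 at1]] := ex_first (fun p => [&& 0 < p, c p & odd p]) n.
have [t2 [t2n below2 at2]] := ex_first (fun p => [&& t1 < p, c p & ~~ odd p]) n.
have t1_gt0 : 0 < t1.
  by rewrite lt0n; apply/eqP => t10; move: at1; rewrite t10 => /(_ n0).
have t2_gt0 : 0 < t2.
  by rewrite lt0n; apply/eqP => t20; move: at2; rewrite t20 => /(_ n0).
pose c' p := [&& 0 < p, p < n, c p & p != t2].
pose T := [pred j | c' j.*2.+1 || c' j.*2.+2].
exists t1, t2, T; split; rewrite ?t1_gt0 ?t2_gt0 // => p /andP[p0 pn].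
(* Even before [t1], odd from [t1] up to [t2], and even after [t2] by [par]. *)
have parc q : c' q -> odd q = (t1 <= q < t2).
  case/and4P => q0 qn cq qt2.
  have b1 := below1 q; have b2 := below2 q; have p12 := par t1 t2 q.
  move: b1 b2 p12; rewrite q0 cq /=.
  have [qt1|t1q] := ltnP q t1; first by move/(_ isT) => /negbTE-> .
  move=> _.
  have [qt|tq] := ltnP q t2.
    move/(_ isT); have [->|ne] := eqVneq q t1 => /=; last first.
      have t1q' : t1 < q by lia.
      by rewrite t1q' negbK.
    by move=> _ _; have /at1/and3P[] : t1 < n by lia.
  move=> _; have /at1/and3P[_ ct1 ->] : t1 < n by lia.
  have /at2/and3P[t12 -> ->] : t2 < n by lia.
  rewrite ct1 t12 t1_gt0 qn /=.
  have t2q : t2 < q by lia.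
  by rewrite t2q => /(_ isT isT isT isT isT isT isT isT) /negbTE.
rewrite /threshold_decode; have [e|pt2] := eqVneq p t2.
  have /at2/and3P[_ ct2 _] : t2 < n by rewrite -e.
  by rewrite e.
have -> : c p = c' p by rewrite /c' p0 pn pt2 andbT.
rewrite /= /T /=; have par_p := parc p.
(* If only the partner of [p] lies in [c'], then, neither being [t2], the parity test rejects
   [p]. *)
have [op|ep] := boolP (odd p).
  have -> : p.-1./2.*2 = p.-1 by lia.
  rewrite prednK //; have [cp|_] /= := boolP (c' p); first by rewrite -par_p ?op.
  have [cp1|//] := boolP (c' p.+1); have /and4P[_ _ _ ne] := cp1.
  have /= := parc _ cp1; rewrite op.
  by case: (t1 <= p < t2) / andP => // -[t1p lt_pt2]; lia.
have -> : p.-1./2.*2.+1 = p.-1 by lia.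
rewrite prednK //; have [cp|_] /= := boolP (c' p).
  by rewrite orbT -par_p ?(negbTE ep).
rewrite orbF; have [cp1|//] := boolP (c' p.-1).
have := parc _ cp1; have -> : odd p.-1 by lia.
by case: (t1 <= p < t2) / andP => // nt; lia.
Qed.


(** * Counting the codes *)

Lemma C_p132_p213_le (n : nat) : 0 < n -> C n p132 p213 <= n ^ 2 * 2 ^ n./2.
Proof.
move=> n0; rewrite /C; set A := finset _.
pose cuts (pi : 'S_n) : {set 'I_n} :=
  finset (fun p : 'I_n => (0 < p) && stable_prefix (pi * rev_perm n)%g p).
have cuts_inj : {in A &, injective cuts}.
  move=> s t; rewrite !inE => /and3P[s1 s2 _] /and3P[t1 t2 _] /setP st.
  apply: (mulIg (rev_perm n)); apply: layered_stable_prefix_inj.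
  - exact: avoids_layered.
  - exact: avoids_layered.
  by move=> p p0; have := st p; rewrite !inE p0.
(* Thresholds range over 1, ..., [n], hence the successors; pair indices stay below [n./2] because
   [0 < p < n]. *)
pose dec (u : 'I_n * 'I_n * {set 'I_(n./2)}) : {set 'I_n} :=
  finset (fun p : 'I_n => (0 < p) && threshold_decode u.1.1.+1 u.1.2.+1
    (fun j => [exists i : 'I_(n./2), (i \in u.2) && (i == j :> nat)]) p).
rewrite -(card_in_imset cuts_inj).
have -> : n ^ 2 * 2 ^ n./2 = #|{: 'I_n * 'I_n * {set 'I_(n./2)}}|.
  by rewrite !card_prod -[#|{set _}|]cardsT -powersetT card_powerset
    cardsT !card_ord mulnn.
apply: leq_trans (leq_imset_card dec _); apply: subset_leq_card.
apply/fintype.subsetP => _ /imsetP[pi + ->]; rewrite inE => /and3P[av1 av2 cyc].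
set t := (pi * rev_perm n)%g.
have tK : involutive t by apply/layered_involutive/avoids_layered.
have revK : (rev_perm n * rev_perm n = 1)%g.
  by apply/permP => x; rewrite !permM !permE rev_ordK.
have cyct : is_cyclic (t * rev_perm n)%g by rewrite /t -mulgA revK mulg1.
have [|t1 [t2 [T [/andP[t10 t1n] /andP[t20 t2n] cE]]]] :=
  @ex_threshold_decode n (stable_prefix t) _ n0.
  move=> p q r p0 pqr rn cp cq cr.
  by apply: (stable_prefix_parity tK cyct cp cq cr pqr); apply: ltnW.
have t1n' : t1.-1 < n by lia.
have t2n' : t2.-1 < n by lia.
apply/imsetP.
exists (Ordinal t1n', Ordinal t2n', finset (fun i : 'I_(n./2) => T i)) => //.
apply/setP => p; rewrite !inE; have [//|p0] := posnP p.
rewrite /= -/t cE ?p0 ?ltn_ord // !prednK // /threshold_decode.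
congr (_ || (_ && _)); apply/idP/existsP => [Tp|[i]].
  have pn : p.-1./2 < n./2 by have := ltn_ord p; lia.
  by exists (Ordinal pn); rewrite inE /= Tp eqxx.
by rewrite inE => /andP[Ti /eqP<-].
Qed.

(** * The bound with a real exponent *)

Local Open Scope ring_scope.

Theorem theorem1p9 (R : realType) (n : nat) (hn : (0 < n)%N) :
  (C n p132 p213)%:R <= n%:R ^+ 2 * 2 `^ (n%:R / 2) :> R.
Proof.
apply: (@le_trans _ _ (n ^ 2 * 2 ^ n./2)%:R).
  by rewrite ler_nat C_p132_p213_le.
rewrite natrM !natrX ler_wpM2l ?exprn_ge0 //.
(* It remains to compare exponents: [n./2] is the rounded-down half of [n]. *)
rewrite -powR_mulrn // ler_powR ?ler1n // ler_pdivlMr // -natrM ler_nat.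
by rewrite muln2 -[leqRHS]odd_double_half leq_addl.
Qed.
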